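(* Let $r\in\mathbb{Z}$ with $|r|\ge2$, and let $u,v\in\mathbb{R}$ with $0<u<v$. Then for every $q\ge1$, $$\left|A(u^{r},v^{r})-L_r^{r}(u,v)\right|\le\frac{(v-u)|r|}{2}\,A^{\frac1q}\left(|u|^{q(r-1)},|v|^{q(r-1)}\right).$$
   Context: For $u,v>0$: $A(u,v)=\frac{u+v}{2}$ is the arithmetic mean, and for $r\in\mathbb{Z}\setminus\{-1,0\}$ and $u\neq v$, $L_r(u,v)=\left[\frac{v^{r+1}-u^{r+1}}{(v-u)(r+1)}\right]^{1/r}$ is the generalized logarithmic mean. $L_r^r(u,v)=(L_r(u,v))^r$ and $A^{1/q}(a,b)=(A(a,b))^{1/q}$. *)

(* Defs.v *)
From mathcomp Require Import all_boot all_order all_algebra.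
From mathcomp Require Import all_classical all_reals all_analysis.

Set Implicit Arguments.
Unset Strict Implicit.
Unset Printing Implicit Defensive.

Import Order.TTheory GRing.Theory Num.Theory.

Local Open Scope ring_scope.

Definition arith_mean (R : realType) (u v : R) : R := (u + v) / 2.

(* Meaningful for r different from -1 and 0 and for u, v > 0 with u != v; the
   base of the real power [`^] is then positive. Elsewhere the value is junk. *)
Definition gen_log_mean (R : realType) (r : int) (u v : R) : R :=
  ((v ^ (r + 1) - u ^ (r + 1)) / ((v - u) * (r + 1)%:~R)) `^ (1 / r%:~R).

(* Main.v *)
Require Import Defs.
From mathcomp Require Import all_boot all_order all_algebra.
From mathcomp Require Import all_classical all_reals all_analysis.
From mathcomp Require Import ring lra.

Import Order.TTheory GRing.Theory Num.Theory.

Local Open Scope ring_scope.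

(** By the mean value theorem for [x ^ (r + 1)], the generalized logarithmic
    mean [L] is a point strictly between [u] and [v]
    ([gen_log_mean_between]). Since [x ^ r] is monotone on the positive reals,
    [L ^ r] lies between [u ^ r] and [v ^ r], so its distance to their midpoint
    is at most half their distance ([exprz_dist_endpoints]).

    That distance is the integral of [|r| x ^ (r - 1)] over [[u, v]], and the
    trapezoid rule overestimates it when [x ^ (r - 1)] is convex. This gives
    the case [q = 1] ([exprz_trapezoid]); it is proved here by algebra, from
    Chebyshev's inequality [0 <= (f a - f b) * (a - b)] for an increasing [f].
    A larger [q] only increases the right-hand side, by the comparison of power
    means ([arith_mean_powR]), which is the convexity of [x `^ q]. *)

(** The point [c] that the mean value theorem provides for [x ^ (r + 1)] on
    [[u, v]] satisfies [c ^ r = (v ^ (r + 1) - u ^ (r + 1)) / ((v - u) (r + 1))].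
    Taking the [r]-th root shows that the logarithmic mean is [c] itself. *)
Lemma gen_log_mean_between (R : realType) (r : int) (u v : R) :
  r != 0 -> r + 1 != 0 -> 0 < u -> u < v ->
  u < gen_log_mean r u v < v.
Proof.
move=> r0 r1 u0 uv.
have pos x : x \in `[u, v] -> 0 < x.
  by rewrite in_itv/= => /andP[+ _]; exact: lt_le_trans.
(* The real power carries a derivative rule valid for exponents of either sign,
   hence the detour through [powR]. *)
have der (x : R) : 0 < x ->
    is_derive x 1 (fun y => y `^ (r + 1)%:~R) ((r + 1)%:~R * x ^ r).
  move=> x0; rewrite -powR_intmul ?ltW//.
  have -> : r%:~R = (r + 1)%:~R - 1 :> R by rewrite intrD addrK.
  exact: is_derive1_powR.
have [||c] := @MVT R (fun y => y `^ (r + 1)%:~R)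
    (fun x => (r + 1)%:~R * x ^ r) u v uv.
- by move=> x /subset_itv_oo_cc /pos x0; exact: der.
- apply: derivable_within_continuous => x /pos x0.
  by case: (der x x0).
rewrite in_itv/= => /andP[uc cv].
have c0 : 0 < c := lt_trans u0 uc.
rewrite !powR_intmul ?(ltW u0) ?(ltW (lt_trans u0 uv))// => def_c.
suff -> : gen_log_mean r u v = c by rewrite uc.
rewrite /gen_log_mean def_c [X in X `^ _](_ : _ = c ^ r).
  by rewrite -powR_intmul ?ltW// -powRrM mulrC divfK ?powRr1 ?ltW// intr_eq0.
have r1R : r%:~R + 1 != 0 :> R.
  by rewrite -[r%:~R + 1]/(r%:~R + 1%:~R) -intrD intr_eq0.
by field; rewrite r1R subr_eq0 gt_eqF.
Qed.

(** Monotonicity of [x ^ r], in a direction that depends on the sign of [r],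
    puts [x ^ r] between the values at the endpoints; a point of a segment is
    within half its length of the midpoint. *)
Lemma exprz_dist_endpoints (R : realType) (r : int) (u x v : R) :
  0 < u -> u <= x -> x <= v ->
  `|arith_mean (u ^ r) (v ^ r) - x ^ r| <= `|v ^ r - u ^ r| / 2.
Proof.
move=> u0 ux xv; rewrite /arith_mean.
have x0 : 0 < x := lt_le_trans u0 ux.
have v0 : 0 < v := lt_le_trans x0 xv.
have [r0|/ltW r0] := leP 0 r.
  have ux_r : u ^ r <= x ^ r by rewrite ler_wpXz2r// nnegrE ltW.
  have xv_r : x ^ r <= v ^ r by rewrite ler_wpXz2r// nnegrE ltW.
  rewrite (ger0_norm (_ : 0 <= v ^ r - u ^ r)); last by lra.
  by rewrite ler_norml; apply/andP; split; lra.
have ux_r : x ^ r <= u ^ r by rewrite ler_wnXz2r ?posrE.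
have xv_r : v ^ r <= x ^ r by rewrite ler_wnXz2r ?posrE.
rewrite (ler0_norm (_ : v ^ r - u ^ r <= 0)); last by lra.
by rewrite ler_norml; apply/andP; split; lra.
Qed.

(** The trapezoid bound for the integral of [(n + 1) x ^ n]. In the induction,
    [2 (a ^ (n + 2) - b ^ (n + 2))] is
    [(a + b) (a ^ (n + 1) - b ^ (n + 1)) + (a - b) (a ^ (n + 1) + b ^ (n + 1))],
    and Chebyshev's inequality
    [(a + b) (a ^ n + b ^ n) <= 2 (a ^ (n + 1) + b ^ (n + 1))]
    absorbs the factor [a + b] left over from the induction hypothesis. *)
Lemma exprn_trapezoid (R : realFieldType) (n : nat) (a b : R) :
  0 <= b -> b <= a ->
  a ^+ n.+1 - b ^+ n.+1 <= n.+1%:R * (a - b) * ((a ^+ n + b ^+ n) / 2).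
Proof.
move=> b0 ba; have a0 : 0 <= a := le_trans b0 ba.
elim: n => [|n IHn]; first by rewrite !expr1 !expr0; lra.
have ab : 0 <= a - b by rewrite subr_ge0.
have chebyshev : 0 <= n.+1%:R * (a - b) * ((a ^+ n - b ^+ n) * (a - b)).
  by rewrite !mulr_ge0 ?ler0n// subr_ge0 lerXn2r ?nnegrE.
have := ler_wpM2l (addr_ge0 a0 b0) IHn.
rewrite -[n.+2%:R]natr1; move: chebyshev.
by rewrite !exprS; nra.
Qed.

(** A negative exponent reduces to a positive one applied to the inverses
    [a = u^-1] and [b = v^-1]: there [v - u = (a - b) / (a b)], and the bound
    that comes out is weaker than [exprn_trapezoid] because
    [a b (a ^ n + b ^ n) <= a ^ (n + 2) + b ^ (n + 2)], again by Chebyshev. *)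
Lemma exprz_trapezoid (R : realFieldType) (r : int) (u v : R) :
  0 < u -> u <= v ->
  `|v ^ r - u ^ r| <= `|r|%:~R * (v - u) * ((u ^ (r - 1) + v ^ (r - 1)) / 2).
Proof.
move=> u0 uv; have v0 : 0 < v := lt_le_trans u0 uv.
case: (intP r) => [|n|n].
- by rewrite !expr0z subrr normr0 !mul0r.
- have -> : n.+1%:Z - 1 = n by rewrite intS addrC addKr.
  rewrite -abszE -!exprnP ger0_norm; last first.
    by rewrite subr_ge0 lerXn2r// nnegrE ltW.
  by rewrite [u ^+ n + _]addrC; exact: exprn_trapezoid _ n _ _ (ltW u0) uv.
have -> : - n.+1%:Z - 1 = - (n.+2%:Z) by rewrite (intS n.+1) addrC opprD.
rewrite normrN -abszE -!exprz_inv -!exprnP distrC.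
have a0 : 0 < u^-1 by rewrite invr_gt0.
have b0 : 0 < v^-1 by rewrite invr_gt0.
have ba : v^-1 <= u^-1 by rewrite lef_pV2.
rewrite ger0_norm; last by rewrite subr_ge0 lerXn2r// nnegrE ltW.
apply: le_trans (exprn_trapezoid _ n _ _ (ltW b0) ba) _.
have -> : v - u = u * v * (u^-1 - v^-1) by field; rewrite !gt_eqF.
have c0 : 0 <= n.+1%:R * (u^-1 - v^-1) / 2.
  by rewrite divr_ge0 ?mulr_ge0 ?ler0n ?subr_ge0.
have chebyshev : 0 <= u * v * ((u^-1 ^+ n.+1 - v^-1 ^+ n.+1) * (u^-1 - v^-1)).
  by rewrite !mulr_ge0 ?subr_ge0 ?lerXn2r ?nnegrE// ltW.
suff: u^-1 ^+ n + v^-1 ^+ n <= u * v * (u^-1 ^+ n.+2 + v^-1 ^+ n.+2).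
  move=> /(ler_wpM2l c0); rewrite -pmulrn absz_nat => le_c.
  by apply: etrans le_c; congr (_ <= _); ring.
rewrite -subr_ge0; move: chebyshev; congr (0 <= _).
by rewrite !exprS; field; rewrite !gt_eqF.
Qed.

(** Jensen's inequality at weight [1 / 2] for the convex function [x `^ q],
    followed by the increasing map [x `^ (1 / q)]. *)
Lemma arith_mean_powR (R : realType) (q x y : R) :
  1 <= q -> 0 <= x -> 0 <= y ->
  arith_mean x y <= arith_mean (x `^ q) (y `^ q) `^ (1 / q).
Proof.
move=> q1 x0 y0; have q0 : 0 < q := lt_le_trans ltr01 q1.
have xy0 : 0 <= arith_mean x y by rewrite /arith_mean; lra.
have le_q : arith_mean x y `^ q <= arith_mean (x `^ q) (y `^ q).
  have h0 : 0 <= 2^-1 :> R by lra.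
  have h1 : 2^-1 <= 1 :> R by lra.
  have meanE (a b : R) : 2^-1 * a + unstable.onem 2^-1 * b = arith_mean a b.
    by rewrite /unstable.onem /arith_mean; lra.
  rewrite -!meanE; apply: (@convex_powR R q q1 (Itv01 h0 h1)).
    by rewrite inE /= in_itv /= x0.
  by rewrite inE /= in_itv /= y0.
have -> : arith_mean x y = (arith_mean x y `^ q) `^ (1 / q).
  by rewrite -powRrM mulrC divfK ?gt_eqF// powRr1.
apply: ge0_ler_powR => //; rewrite ?nnegrE ?powR_ge0//.
  by rewrite divr_ge0// ltW.
by rewrite (le_trans _ le_q) ?powR_ge0.
Qed.

Theorem proposition2 (R : realType) (r : int) (hr : 2 <= `|r|)
    (u v : R) (hu : 0 < u) (huv : u < v) (q : R) (hq : 1 <= q) :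
  `| arith_mean (u ^ r) (v ^ r) - (gen_log_mean r u v) ^ r |
    <= (v - u) * `|r|%:~R / 2
       * (arith_mean (`|u| `^ (q * (r - 1)%:~R)) (`|v| `^ (q * (r - 1)%:~R)))
           `^ (1 / q).
Proof.
have v0 : 0 < v := lt_trans hu huv.
have r0 : r != 0 by apply: contraTneq hr => ->.
have r1 : r + 1 != 0 by rewrite addr_eq0; apply: contraTneq hr => ->.
have /andP[uL Lv] := gen_log_mean_between R r u v r0 r1 hu huv.
apply: le_trans (exprz_dist_endpoints R r _ _ _ hu (ltW uL) (ltW Lv)) _.
have c0 : 0 <= (v - u) * `|r|%:~R / 2.
  by rewrite divr_ge0 ?mulr_ge0 ?subr_ge0 ?ler0z ?(ltW huv).
rewrite (gtr0_norm hu) (gtr0_norm v0) (mulrC q) !(powRrM _ (r - 1)%:~R).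
rewrite (powR_intmul (r - 1) (ltW hu)) (powR_intmul (r - 1) (ltW v0)).
apply: le_trans (ler_wpM2l c0 (arith_mean_powR _ _ _ _ hq
   (exprz_ge0 _ (ltW hu)) (exprz_ge0 _ (ltW v0)))).
have := exprz_trapezoid R r u v hu (ltW huv); rewrite /arith_mean; lra.
Qed.
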